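(* Let $\omega\ge0$ and let $\xi\ge0$ be such that the matrix $D_\xi=D^TD-\xi^2I$ is nonsingular. The following statements are equivalent: 1. $\det H_N(j\omega,\xi)=0$; 2. $j\omega$ is an eigenvalue of $\mathcal{L}_\xi^N$; 3. $\xi^2$ is an eigenvalue of the matrix $$M_N(j\omega):=\begin{bmatrix}X_N(j\omega)+X_N(j\omega)^*+Y_N(j\omega)^*Y_N(j\omega)+D^TD&\sqrt{r_N(\omega)}\,X_N(j\omega)^*\\\sqrt{r_N(\omega)}\,X_N(j\omega)&D^TD\end{bmatrix},$$ where $$X_N(j\omega)=D^TC\Big(j\omega I-A_0-\sum_{i=1}^mA_ip_N(-\tau_i;j\omega)\Big)^{-1}B\,p_N(\tau_0;j\omega),$$ $$Y_N(j\omega)=C\Big(j\omega I-A_0-\sum_{i=1}^mA_ip_N(-\tau_i;j\omega)\Big)^{-1}B,\qquad r_N(\omega)=\frac{1}{|p_N(-\tau_0;j\omega)|^2}-1.$$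
   Context: Here $j$ is the imaginary unit, ${}^*$ is conjugate transpose, $A_0,\dots,A_m\in\mathbb{R}^{n\times n}$, $B\in\mathbb{R}^{n\times n_u}$, $C\in\mathbb{R}^{n_y\times n}$, $D\in\mathbb{R}^{n_y\times n_u}$, and $\tau_0,\dots,\tau_m\ge0$ with $\max_{0\le i\le m}\tau_i=1$. With $D_\xi=D^TD-\xi^2I$ put $$M_0=\begin{bmatrix}A_0&-BD_\xi^{-1}B^T\\-C^TC+C^TDD_\xi^{-1}D^TC&-A_0^T\end{bmatrix},\ M_i=\begin{bmatrix}A_i&0\\0&0\end{bmatrix},\ M_{-i}=\begin{bmatrix}0&0\\0&-A_i^T\end{bmatrix}\ (1\le i\le m),$$ $$N_1=\begin{bmatrix}0&0\\0&C^TDD_\xi^{-1}B^T\end{bmatrix},\ N_{-1}=\begin{bmatrix}-BD_\xi^{-1}D^TC&0\\0&0\end{bmatrix}.$$ Grid: $N$ is a positive integer and $-1\le\theta_{N,-N}<\dots<\theta_{N,-1}<\theta_{N,0}=0<\theta_{N,1}<\dots<\theta_{N,N}\le1$ with $\theta_{N,-i}=-\theta_{N,i}$. Matrix $\mathcal{L}_\xi^N$: for a block vector $x=(x_{-N},\dots,x_N)$ with $x_i\in\mathbb{C}^{2n}$, let $\mathcal{P}_Nx$ be the unique $\mathbb{C}^{2n}$-valued polynomial of degree $\le2N$ with $\mathcal{P}_Nx(\theta_{N,i})=x_i$ for $i=-N,\dots,N$. Then $\mathcal{L}_\xi^N$ is the linear map (matrix) on $\mathbb{C}^{(2N+1)2n}$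 with $(\mathcal{L}_\xi^Nx)_i=(\mathcal{P}_Nx)'(\theta_{N,i})$ for $i\ne0$ and $$(\mathcal{L}_\xi^Nx)_0=M_0\mathcal{P}_Nx(0)+\sum_{i=1}^m(M_i\mathcal{P}_Nx(-\tau_i)+M_{-i}\mathcal{P}_Nx(\tau_i))+N_1\mathcal{P}_Nx(-\tau_0)+N_{-1}\mathcal{P}_Nx(\tau_0).$$ Polynomial $p_N$: for $\lambda\in\mathbb{C}$, $p_N(\cdot;\lambda)$ is the scalar polynomial of degree at most $2N$ satisfying $p_N(0;\lambda)=1$ and $p_N'(\theta_{N,i};\lambda)=\lambda p_N(\theta_{N,i};\lambda)$ for $i\in\{-N,\dots,-1,1,\dots,N\}$ (derivative in the first argument). Put $$H_N(\lambda,\xi)=\lambda I-M_0-\sum_{i=1}^m(M_ip_N(-\tau_i;\lambda)+M_{-i}p_N(\tau_i;\lambda))-(N_1p_N(-\tau_0;\lambda)+N_{-1}p_N(\tau_0;\lambda)).$$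
   Formalization: The equivalence with statement 3 is asserted when the matrix inverted in X_N and Y_N is nonsingular and p_N(-τ_0;jω) ≠ 0, since otherwise M_N(jω) is undefined; 1⇔2 is unconditional; for negative r_N the square root is complex. *)

(* Defs.v *)
From HB Require Import structures.
From mathcomp Require Import all_boot all_order all_algebra.
From mathcomp Require Import complex.
From mathcomp Require Import boolp classical_sets.

Set Implicit Arguments.
Unset Strict Implicit.
Unset Printing Implicit Defensive.

Import Order.TTheory GRing.Theory Num.Theory.
Local Open Scope ring_scope.
Local Open Scope complex_scope.

Definition mxC (R : rcfType) (p q : nat) (M : 'M[R]_(p, q)) : 'M[R[i]]_(p, q) :=
  map_mx (real_complex R) M.

Definition ctmx (R : rcfType) (p q : nat) (M : 'M[R[i]]_(p, q)) :
  'M[R[i]]_(q, p) := map_mx Num.conj M^T.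

Section Grid.
Variables (R : rcfType) (N : nat).

(* The index i in {-N, ..., N} is encoded by the ordinal i + N, so that -i is
   encoded by rev_ord and 0 by mid. *)
Definition mid : 'I_(N.*2.+1) := inord N.

Definition is_grid (theta : 'I_(N.*2.+1) -> R) : Prop :=
  [/\ forall i, -1 <= theta i <= 1,
      forall i k : 'I_(N.*2.+1), (i < k)%N -> theta i < theta k,
      theta mid = 0 &
      forall i, theta (rev_ord i) = - theta i].

Variable theta : 'I_(N.*2.+1) -> R.

Definition node (i : 'I_(N.*2.+1)) : R[i] := (theta i)%:C.

Definition is_interp (v : 'I_(N.*2.+1) -> R[i]) (p : {poly R[i]}) : Prop :=
  (size p <= N.*2.+1)%N /\ forall i, p.[node i] = v i.

Definition interp (v : 'I_(N.*2.+1) -> R[i]) : {poly R[i]} :=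
  xget 0 [set p | is_interp v p]%classic.

Definition is_pN (lam : R[i]) (p : {poly R[i]}) : Prop :=
  [/\ (size p <= N.*2.+1)%N,
      p.[0] = 1 &
      forall i, i != mid -> p^`().[node i] = lam * p.[node i]].

(* When theta is a grid, is_pN lam has a unique solution for all but finitely
   many lam, and in particular for every purely imaginary lam. *)
Definition pN (lam : R[i]) : {poly R[i]} :=
  xget 0 [set p | is_pN lam p]%classic.

(* A block vector (x_(-N), ..., x_N) with blocks in C^d is the matrix whose row
   of index i is the transpose of x_i. *)
Definition PN (d : nat) (x : 'M[R[i]]_(N.*2.+1, d)) : 'cV[{poly R[i]}]_d :=
  \col_k interp (fun i => x i k).

End Grid.

Definition evalcv (R : rcfType) (d : nat) (P : 'cV[{poly R[i]}]_d) (t : R[i]) :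
  'cV[R[i]]_d := map_mx (horner_eval t) P.

Definition derivcv (R : rcfType) (d : nat) (P : 'cV[{poly R[i]}]_d) :
  'cV[{poly R[i]}]_d := map_mx (@deriv _) P.

Section System.
Variables (R : rcfType) (n nu ny m : nat).
Variables (A : 'I_m.+1 -> 'M[R]_n).
Variables (B : 'M[R]_(n, nu)) (C : 'M[R]_(ny, n)) (D : 'M[R]_(ny, nu)).
Variable tau : 'I_m.+1 -> R.

Definition Dxi (xi : R) : 'M[R]_nu := D^T *m D - (xi ^+ 2)%:M.

Definition M0 (xi : R) : 'M[R]_(n + n) :=
  block_mx (A ord0) (- (B *m invmx (Dxi xi) *m B^T))
           (- (C^T *m C) + C^T *m D *m invmx (Dxi xi) *m D^T *m C)
           (- (A ord0)^T).

Definition Mpos (i : 'I_m.+1) : 'M[R]_(n + n) := block_mx (A i) 0 0 0.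

Definition Mneg (i : 'I_m.+1) : 'M[R]_(n + n) := block_mx 0 0 0 (- (A i)^T).

Definition N1 (xi : R) : 'M[R]_(n + n) :=
  block_mx 0 0 0 (C^T *m D *m invmx (Dxi xi) *m B^T).

Definition Nm1 (xi : R) : 'M[R]_(n + n) :=
  block_mx (- (B *m invmx (Dxi xi) *m D^T *m C)) 0 0 0.

Variables (N : nat) (theta : 'I_(N.*2.+1) -> R).

Definition Lmap (xi : R) (x : 'M[R[i]]_(N.*2.+1, n + n)) :
    'M[R[i]]_(N.*2.+1, n + n) :=
  let P := PN theta x in
  \matrix_(i, k)
    (if i == mid N then
       mxC (M0 xi) *m evalcv P 0
       + \sum_(l < m.+1 | l != ord0)
           (mxC (Mpos l) *m evalcv P (- tau l)%:C
            + mxC (Mneg l) *m evalcv P (tau l)%:C)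
       + mxC (N1 xi) *m evalcv P (- tau ord0)%:C
       + mxC (Nm1 xi) *m evalcv P (tau ord0)%:C
     else evalcv (derivcv P) (node theta i)) k 0.

(* lin_mx produces the matrix acting on row vectors, which is also the
   convention of eigenvalue: lam is an eigenvalue of LN exactly when
   Lmap x = lam *: x for some nonzero x. *)
Definition LN (xi : R) : 'M[R[i]]_(N.*2.+1 * (n + n)) := lin_mx (Lmap xi).

Definition HN (lam : R[i]) (xi : R) : 'M[R[i]]_(n + n) :=
  let p := pN theta lam in
  lam%:M - mxC (M0 xi)
  - \sum_(l < m.+1 | l != ord0)
      (p.[(- tau l)%:C] *: mxC (Mpos l) + p.[(tau l)%:C] *: mxC (Mneg l))
  - (p.[(- tau ord0)%:C] *: mxC (N1 xi) + p.[(tau ord0)%:C] *: mxC (Nm1 xi)).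

Definition charmx (lam : R[i]) : 'M[R[i]]_n :=
  lam%:M - mxC (A ord0)
  - \sum_(l < m.+1 | l != ord0) (pN theta lam).[(- tau l)%:C] *: mxC (A l).

Definition XN (lam : R[i]) : 'M[R[i]]_nu :=
  (pN theta lam).[(tau ord0)%:C] *:
    (mxC (D^T *m C) *m invmx (charmx lam) *m mxC B).

Definition YN (lam : R[i]) : 'M[R[i]]_(ny, nu) :=
  mxC C *m invmx (charmx lam) *m mxC B.

Definition rN (omega : R) : R[i] :=
  (`|(pN theta (0 +i* omega)).[(- tau ord0)%:C]| ^+ 2)^-1 - 1.

(* rN may be negative, hence the complex square root. *)
Definition MN (omega : R) : 'M[R[i]]_(nu + nu) :=
  let X := XN (0 +i* omega) in
  let Y := YN (0 +i* omega) in
  block_mx (X + ctmx X + ctmx Y *m Y + mxC (D^T *m D)) (sqrtC (rN omega) *: ctmx X)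
           (sqrtC (rN omega) *: X) (mxC (D^T *m D)).

End System.

Section Wellposedness.
Variables (R : rcfType) (N : nat) (theta : 'I_(N.*2.+1) -> R).
Hypothesis theta_grid : is_grid theta.

Lemma node_inj : injective (node theta).
Proof.
move=> i k /complexI eq_ik; case: theta_grid => _ mono _ _.
by apply: val_inj; case: (ltngtP i k) => // /mono; rewrite eq_ik ltxx.
Qed.

Lemma is_interp_uniq v p q :
  is_interp theta v p -> is_interp theta v q -> p = q.
Proof.
move=> [sp vp] [sq vq]; apply/eqP; rewrite -subr_eq0; apply: contraT => pq0.
have: (size [seq node theta i | i : 'I_(N.*2.+1)] < size (p - q)%R)%N.
  apply: max_poly_roots => //.
    by apply/allP => _ /mapP[i _ ->]; rewrite /root !hornerE vp vq subrr.
  by rewrite map_inj_uniq ?enum_uniq //; apply: node_inj.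
rewrite size_map size_enum_ord ltnNge.
by rewrite (leq_trans (size_polyD _ _)) // size_polyN geq_max sp sq.
Qed.

Lemma interpP v : is_interp theta v (interp theta v).
Proof.
pose ell i : {poly R[i]} := \prod_(k | k != i) ('X - (node theta k)%:P).
have ellE i k : k != i -> (ell i).[node theta k] = 0.
  by move=> ki; rewrite horner_prod (bigD1 k) //= hornerXsubC subrr mul0r.
have ell_neq0 i : (ell i).[node theta i] != 0.
  rewrite horner_prod; apply/prodf_neq0 => k ki.
  by rewrite hornerXsubC subr_eq0 (inj_eq node_inj) eq_sym.
apply: (xgetPex 0 (P := [set p | is_interp theta v p]%classic)).
exists (\sum_i (v i / (ell i).[node theta i]) *: ell i); split => [|i].
  rewrite (leq_trans (size_sum _ _ _)) //; apply/bigmax_leqP => i _.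
  rewrite (leq_trans (size_scale_leq _ _)) // /ell.
  rewrite -big_filter size_prod_XsubC.
  have := cardC1 i; rewrite cardE card_ord => eqN.
  by rewrite (_ : size _ = N.*2).
rewrite horner_sum (bigD1 i) //= hornerZ divfK // big1 ?addr0 // => k ki.
have ik : i != k by rewrite eq_sym.
by rewrite hornerZ (ellE _ _ ik) mulr0.
Qed.

Lemma interpD a v w :
  interp theta (fun i => a * v i + w i) = a *: interp theta v + interp theta w.
Proof.
apply: is_interp_uniq; first exact: interpP.
have [sv ev] := interpP v; have [sw ew] := interpP w; split => [|i].
  rewrite (leq_trans (size_polyD _ _)) // geq_max sw andbT.
  by rewrite (leq_trans (size_scale_leq _ _)).
by rewrite hornerD hornerZ ev ew.
Qed.

End Wellposedness.

Lemma mul_vec_LN (R : rcfType) (n nu ny m N : nat) (A : 'I_m.+1 -> 'M[R]_n)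
    (B : 'M[R]_(n, nu)) (C : 'M[R]_(ny, n)) (D : 'M[R]_(ny, nu))
    (tau : 'I_m.+1 -> R) (theta : 'I_(N.*2.+1) -> R) (xi : R)
    (x : 'M[R[i]]_(N.*2.+1, n + n)) :
  is_grid theta ->
  mxvec x *m LN A B C D tau theta xi = mxvec (Lmap A B C D tau theta xi x).
Proof.
move=> gT.
have PND a y z : PN theta (a *: y + z) =
    \col_k (a *: PN theta y k 0 + PN theta z k 0) :> 'cV_(n + n).
  apply/colP => k; rewrite !mxE -interpD //; congr interp.
  by apply/funext => i; rewrite !mxE.
have eD a y z t : evalcv (PN theta (a *: y + z)) t =
    a *: evalcv (PN theta y) t + evalcv (PN theta z) t :> 'cV_(n + n).
  by rewrite PND; apply/colP => k; rewrite !mxE /horner_eval hornerD hornerZ.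
have dD a y z t : evalcv (derivcv (PN theta (a *: y + z))) t =
    a *: evalcv (derivcv (PN theta y)) t + evalcv (derivcv (PN theta z)) t
    :> 'cV_(n + n).
  rewrite PND; apply/colP => k.
  by rewrite !mxE /horner_eval derivD derivZ hornerD hornerZ.
have ac4 (x1 y1 x2 y2 x3 y3 x4 y4 : 'cV[R[i]]_(n + n)) :
    x1 + y1 + (x2 + y2) + (x3 + y3) + (x4 + y4) =
    x1 + x2 + x3 + x4 + (y1 + y2 + y3 + y4).
  by rewrite (addrACA x1) (addrACA (x1 + x2)) (addrACA (x1 + x2 + x3)).
have linL : linear (Lmap A B C D tau theta xi).
  move=> a y z; apply/matrixP => i k; rewrite [LHS]mxE [RHS]mxE [in RHS]mxE.
  rewrite [Lmap _ _ _ _ _ _ _ y i k]mxE [Lmap _ _ _ _ _ _ _ z i k]mxE.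
  case: ifP => _; last by rewrite dD !mxE.
  rewrite (_ : forall u v : 'cV[R[i]]_(n + n), a * u k 0 + v k 0 =
    (a *: u + v) k 0); last by move=> u v; rewrite !mxE.
  congr (fun_of_matrix _ k 0); rewrite !eD !mulmxDr -!scalemxAr !scalerDr.
  rewrite (eq_bigr (fun l : 'I_m.+1 => a *: (mxC (Mpos A l) *m
      evalcv (PN theta y) (- tau l)%:C + mxC (Mneg A l) *m
      evalcv (PN theta y) (tau l)%:C) + (mxC (Mpos A l) *m
      evalcv (PN theta z) (- tau l)%:C + mxC (Mneg A l) *m
      evalcv (PN theta z) (tau l)%:C))); last first.
    by move=> l _; rewrite !eD !mulmxDr -!scalemxAr scalerDr addrACA.
  by rewrite big_split /= -scaler_sumr ac4.
pose L := GRing.isLinear.Build _ _ _ _ (Lmap A B C D tau theta xi) linL.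
pose Lf : {linear _ -> _} := HB.pack (Lmap A B C D tau theta xi) L.
exact: (mul_vec_lin Lf x).
Qed.

(* Main.v *)
(* Collocation off the midpoint means that [p' - lam p] is a multiple of
   [node_poly], the product of the [X - theta_i] with [i <> 0].  Together with
   the symmetry of the grid this makes p_N well defined at [lam = j omega] and
   gives p_N(-t) = conj p_N(t) for real t.  An eigenvector of L_xi^N for
   [j omega] therefore samples [p_N v] with [v] its middle block, whose row
   becomes [H_N v = 0].

   For the third statement, let E be the delayed characteristic matrix.  Then
   H_N is the block triangular matrix [[E, 0], [C^T C, -E^*]] plus a
   perturbation factoring through diag(D_xi, D_xi), and [det (1 + Z T) =
   det (1 + T Z)] turns its singularity into that of [M_N - xi^2]. *)
Require Import Defs.
From HB Require Import structures.
From mathcomp Require Import all_boot all_order all_algebra.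
From mathcomp Require Import complex zify.
From mathcomp Require Import classical_sets.

Set Implicit Arguments.
Unset Strict Implicit.
Unset Printing Implicit Defensive.

Import Order.TTheory GRing.Theory Num.Theory.
Local Open Scope ring_scope.
Local Open Scope complex_scope.

Lemma coef_comp_scaleX (K : comNzRingType) (p : {poly K}) (c : K) (k : nat) :
  (p \Po (c *: 'X))`_k = c ^+ k * p`_k.
Proof.
rewrite coef_comp_poly.
under eq_bigr => i _ do rewrite exprZn coefZ coefXn.
have [kp|kp] := ltnP k (size p); last first.
  rewrite (nth_default _ kp) mulr0 big1 // => i _.
  by rewrite gtn_eqF ?mulr0 // (leq_trans (ltn_ord i)).
rewrite (bigD1 (Ordinal kp)) //= eqxx mulr1 mulrC big1 ?addr0 // => i ik.
by rewrite (_ : (k == i) = false) ?mulr0 //; apply/eqP => ki;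
   case/eqP: ik; apply: val_inj.
Qed.

(** * The node polynomial and a solution of the collocation equation *)

Section Collocation.
Variables (R : rcfType) (N : nat) (theta : 'I_(N.*2.+1) -> R).
Hypothesis theta_grid : is_grid theta.

Lemma val_mid : mid N = N :> nat.
Proof. by rewrite inordK // ltnS -addnn leq_addr. Qed.

Lemma node_mid : node theta (mid N) = 0.
Proof. by rewrite /node; case: theta_grid => _ _ ->. Qed.

Lemma node_rev i : node theta (rev_ord i) = - node theta i.
Proof. by rewrite /node; case: theta_grid => _ _ _ ->; rewrite rmorphN. Qed.

Lemma node_neq0 i : i != mid N -> node theta i != 0.
Proof. by rewrite -node_mid (inj_eq (node_inj theta_grid)). Qed.

Definition node_poly : {poly R[i]} :=
  \prod_(i < N.*2.+1 | i != mid N) ('X - (node theta i)%:P).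

Lemma size_node_poly : size node_poly = N.*2.+1.
Proof.
rewrite /node_poly -big_filter size_prod_XsubC.
have := cardC1 (mid N); rewrite cardE card_ord => eqN.
by rewrite (_ : size _ = N.*2).
Qed.

Lemma node_poly_root i : i != mid N -> node_poly.[node theta i] = 0.
Proof.
by move=> im; rewrite horner_prod (bigD1 i) //= hornerXsubC subrr mul0r.
Qed.

Lemma node_poly0_neq0 : node_poly.[0] != 0.
Proof.
rewrite horner_prod; apply/prodf_neq0 => i im.
by rewrite hornerXsubC sub0r oppr_eq0 node_neq0.
Qed.

(** With the scalar chosen to match values at the middle node 0, both sides interpolate the same
    data at all [2N+1] nodes. *)
Lemma vanish_off_mid (q : {poly R[i]}) :
  (size q <= N.*2.+1)%N -> (forall i, i != mid N -> q.[node theta i] = 0) ->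
  exists c, q = c *: node_poly.
Proof.
move=> sq q0; exists (q.[0] / node_poly.[0]).
apply: (is_interp_uniq theta_grid (v := fun i => q.[node theta i])); split=> //.
  by rewrite (leq_trans (size_scale_leq _ _)) ?size_node_poly.
move=> i; rewrite hornerZ; have [->|im] := eqVneq i (mid N).
  by rewrite node_mid divfK ?node_poly0_neq0.
by rewrite q0 // node_poly_root ?mulr0.
Qed.

Lemma node_poly_sym :
  node_poly = \prod_(i < N.*2.+1 | (i < N)%N) ('X^2 - (node theta i ^+ 2)%:P).
Proof.
rewrite /node_poly (bigID (fun i : 'I_(N.*2.+1) => (i < N)%N)) /=.
rewrite [X in _ * X](reindex_inj rev_ord_inj) /=.
have E1 (i : 'I_(N.*2.+1)) : (i != mid N) && (i < N)%N = (i < N)%N.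
  by rewrite -val_eqE /= val_mid; case: ltngtP.
have E2 (i : 'I_(N.*2.+1)) :
    (rev_ord i != mid N) && ~~ (rev_ord i < N)%N = (i < N)%N.
  by rewrite -val_eqE /= val_mid; have := ltn_ord i; lia.
rewrite (eq_bigl _ _ E1) (eq_bigl _ _ E2) -big_split /=.
apply: eq_bigr => i _.
by rewrite node_rev rmorphN opprK -subr_sqr rmorphXn.
Qed.

Variable omega : R.
Local Notation lam := (0 +i* omega).

Lemma lam_sqr : lam ^+ 2 = - (omega ^+ 2)%:C.
Proof.
apply/eqP; rewrite eq_complex /=.
by rewrite !(mul0r, mulr0, addr0, oppr0, sub0r) !eqxx.
Qed.

Hypothesis omega_neq0 : omega != 0.

Lemma lam_neq0 : lam != 0.
Proof. by rewrite eq_complex /= negb_and omega_neq0 orbT. Qed.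

(* [resolvent] solves [S' - lam S = - node_poly], so it is p_N up to scaling. *)
Definition resolvent : {poly R[i]} :=
  \sum_(k < N.*2.+1) lam^-1 ^+ k.+1 *: node_poly^`(k).

Lemma size_resolvent : (size resolvent <= N.*2.+1)%N.
Proof.
rewrite (leq_trans (size_sum _ _ _)) //; apply/bigmax_leqP => k _.
rewrite (leq_trans (size_scale_leq _ _)) //.
elim: (k : nat) => [|j IHj]; first by rewrite derivn0 size_node_poly.
rewrite derivnS (leq_trans _ IHj) //.
have [->|/lt_size_deriv/ltnW //] := eqVneq (node_poly^`(j)) 0.
by rewrite deriv0.
Qed.

(** The sum telescopes: differentiation shifts it by one index, and the top term dies because
    [node_poly] has degree [2N]. *)
Lemma deriv_resolvent : resolvent^`() = lam *: resolvent - node_poly.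
Proof.
rewrite /resolvent [X in X^`()]big_ord_recr big_ord_recl /=.
rewrite derivD derivZ -derivnS.
rewrite (derivn_poly0 (n := N.*2.+1)) ?size_node_poly // scaler0 addr0.
rewrite scalerDr scalerA expr1 divff ?lam_neq0 // scale1r addrAC subrr add0r.
rewrite scaler_sumr raddf_sum /=; apply: eq_bigr => k _.
rewrite derivZ -derivnS scalerA /= /bump /= add1n [in RHS]exprS.
by rewrite mulVKf ?lam_neq0.
Qed.

(* The roots of [node_poly] come in pairs [+-theta] and [lam ^ 2 <= 0], hence
   [node_poly (lam^-1 X)] has, up to a global sign, nonnegative coefficients. *)
Lemma resolvent0_neq0 : resolvent.[0] != 0.
Proof.
set c := lam^-1.
have c2 : c ^+ 2 = - ((omega ^+ 2)^-1)%:C.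
  by rewrite /c exprVn lam_sqr invrN fmorphV.
pose F i : {poly R[i]} := ((omega ^+ 2)^-1)%:C *: 'X^2 + ((theta i ^+ 2)%:C)%:P.
pose s := \prod_(i < N.*2.+1 | (i < N)%N) F i.
pose e : R[i] := (-1) ^+ #|[pred i : 'I_(N.*2.+1) | (i < N)%N]|.
have sE : node_poly \Po (c *: 'X) = e *: s.
  rewrite node_poly_sym rmorph_prod /=.
  rewrite (eq_bigr (fun i => - F i)); last first.
    move=> i _; rewrite rmorphB /= comp_polyC rmorphXn /= comp_polyX exprZn c2.
    by rewrite scaleNr -opprD /F (rmorphXn (real_complex R)).
  rewrite [LHS](prodrN [pred i : 'I_(N.*2.+1) | (i < N)%N]) /e -mul_polyC.
  by rewrite polyC_exp polyCN polyC1.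
have s_ge0 k : 0 <= s`_k.
  move: k; apply: (big_ind (fun p : {poly R[i]} => forall k, 0 <= p`_k)) => /=.
  - by move=> k; rewrite coef1 ler0n.
  - move=> p q p_ge0 q_ge0 k; rewrite coefM sumr_ge0 // => i _.
    by rewrite mulr_ge0.
  - move=> i _ k; rewrite coefD coefZ coefXn coefC addr_ge0 //.
      by rewrite mulr_ge0 ?ler0n // ler0c invr_ge0 sqr_ge0.
    by case: ifP => // _; rewrite ler0c sqr_ge0.
have s0_gt0 : 0 < s`_0.
  rewrite lt_def s_ge0 andbT -horner_coef0 horner_prod.
  apply/prodf_neq0 => i iN.
  rewrite !hornerE /= mulr0 add0r rmorphXn expf_neq0 //.
  by rewrite node_neq0 // -val_eqE /= val_mid ltn_eqF.
(* The [k]-th derivative at 0 is [k!] times the [k]-th coefficient, and [c ^+ k] is absorbed by the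
   substitution [c *: 'X]. The remaining sum is positive already through its term [k = 0]. *)
have -> : resolvent.[0] = c * e * \sum_(k < N.*2.+1) s`_k *+ k`!.
  rewrite /resolvent horner_sum mulr_sumr; apply: eq_bigr => k _.
  rewrite hornerZ horner_coef0 coef_derivn addn0 ffactnn exprS -/c.
  rewrite !mulrnAr -[in LHS]mulrA -[in RHS]mulrA; congr ((_ * _) *+ _).
  by rewrite -coef_comp_scaleX sE coefZ.
rewrite !mulf_neq0 ?invr_eq0 ?lam_neq0 ?signr_eq0 //.
rewrite big_ord_recl /= gt_eqF // ltr_wpDr ?mulrn_wge0 // sumr_ge0 // => k _.
by rewrite mulrn_wge0.
Qed.

End Collocation.

(** * Existence, uniqueness and conjugation symmetry of [pN] *)

Section PNSpec.
Variables (R : rcfType) (N : nat) (theta : 'I_(N.*2.+1) -> R).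
Hypothesis theta_grid : is_grid theta.
Variable omega : R.
Local Notation lam := (0 +i* omega).

Lemma collocation_eq0 (q : {poly R[i]}) :
  (size q <= N.*2.+1)%N -> q.[0] = 0 ->
  (forall i, i != mid N -> q^`().[node theta i] = lam * q.[node theta i]) ->
  q = 0.
Proof.
move=> sq q0 qE.
have sq' : (size q^`() <= N.*2.+1)%N.
  have [->|/lt_size_deriv/ltnW qq] := eqVneq q 0.
    by rewrite deriv0 size_poly0.
  exact: leq_trans sq.
have [|i im|c qc] := vanish_off_mid theta_grid (q := q^`() - lam *: q).
- rewrite (leq_trans (size_polyD _ _)) // geq_max sq' size_polyN.
  by rewrite (leq_trans (size_scale_leq _ _)).
- by rewrite hornerD hornerN hornerZ qE // subrr.
have q'E : q^`() = lam *: q + c *: node_poly theta by rewrite -qc addrC subrK.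
have [om0|om0] := eqVneq omega 0; last first.
  (* This combination solves [r' = lam r] exactly, which for [lam != 0] forces [r = 0] by degree;
     its value at 0 then gives [c = 0]. *)
  have r0 : q + c *: resolvent theta omega = 0.
    apply/eqP/contraT => /lt_size_deriv.
    rewrite derivD derivZ deriv_resolvent // scalerBr q'E addrACA subrr addr0.
    rewrite scalerA (mulrC c) -scalerA -scalerDr.
    by rewrite size_scale ?lam_neq0 ?ltnn.
  have /eqP := congr1 (horner^~ 0) r0.
  rewrite !hornerE q0 add0r mulf_eq0 (negPf (resolvent0_neq0 _ _)) // orbF.
  by move=> /eqP c0; move: r0; rewrite c0 scale0r addr0.
have lam0 : lam = 0 by rewrite om0.
rewrite lam0 scale0r add0r in q'E.
(* For [lam = 0], a nonzero [c] would give [q'] degree [2N], too large for the derivative of [q]. *)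
have q'0 : q^`() = 0.
  have [->|qn0] := eqVneq q 0; first by rewrite deriv0.
  have := leq_trans (lt_size_deriv qn0) sq; rewrite q'E.
  have [->|cn0] := eqVneq c 0; first by rewrite scale0r.
  by rewrite size_scale // size_node_poly ltnn.
apply/polyP => -[|k]; rewrite coef0; first by rewrite -horner_coef0.
have /eqP := congr1 (fun p : {poly R[i]} => p`_k) q'0.
by rewrite coef_deriv coef0 mulrn_eq0 => /eqP.
Qed.

Lemma is_pN_uniq p q : is_pN theta lam p -> is_pN theta lam q -> p = q.
Proof.
move=> [sp p0 pE] [sq q0 qE]; apply/eqP; rewrite -subr_eq0; apply/eqP.
apply: collocation_eq0 => [||i im].
- by rewrite (leq_trans (size_polyD _ _)) // geq_max sp size_polyN.
- by rewrite hornerD hornerN p0 q0 subrr.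
- by rewrite derivB !hornerD !hornerN pE // qE // mulrBr.
Qed.

(** [xget] falls back on 0, so a witness is required: the constant 1 if [omega = 0], otherwise
    [resolvent] divided by its nonzero value at 0. *)
Lemma pNP : is_pN theta lam (pN theta lam).
Proof.
apply: (xgetPex 0 (P := [set p | is_pN theta lam p]%classic)).
have [om0|om0] := eqVneq omega 0.
  exists 1; split=> [||i _]; rewrite ?size_poly1 ?hornerE //.
  by rewrite derivC om0 !hornerE.
have S0 := resolvent0_neq0 theta_grid om0.
exists ((resolvent theta omega).[0]^-1 *: resolvent theta omega); split.
- by rewrite (leq_trans (size_scale_leq _ _)) ?size_resolvent.
- by rewrite hornerZ mulVf.
move=> i im; rewrite derivZ deriv_resolvent // !hornerZ hornerD hornerN hornerZ.
by rewrite node_poly_root // subr0 mulrCA.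
Qed.

Lemma conj_lam : Num.conj lam = - lam.
Proof. by apply/eqP; rewrite eq_complex /= oppr0 !eqxx. Qed.

(** The polynomial [z |-> conj p(- conj z)] meets the same conditions: the grid is symmetric, and
    the sign from the chain rule cancels the one in [conj lam = - lam]. Uniqueness concludes. *)
Lemma pN_conj (t : R) :
  (pN theta lam).[t%:C] = Num.conj (pN theta lam).[(- t)%:C].
Proof.
have [sp p0 pE] := pNP; set p := pN theta lam in sp p0 pE *.
pose q := map_poly Num.conj p \Po - 'X.
have qE z : q.[z] = Num.conj p.[- Num.conj z].
  rewrite horner_comp !hornerE -horner_map /=; congr (_.[_]).
  by rewrite rmorphN /= conjCK.
suff -> : p.[t%:C] = q.[t%:C].
  by rewrite qE rmorphN; congr (Num.conj p.[- _]); apply: conjc_real.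
congr (_.[_]); apply: is_pN_uniq; first exact: pNP.
split=> [||i im].
- by rewrite size_comp_poly2 ?size_polyN ?size_polyX // size_map_poly.
- by rewrite qE rmorph0 oppr0 p0 rmorph1.
have conj_node k : Num.conj (node theta k) = node theta k by apply: conjc_real.
have rim : rev_ord i != mid N.
  by move: im; rewrite -!val_eqE /= val_mid; have := ltn_ord i; lia.
rewrite qE conj_node -node_rev // deriv_comp deriv_map derivN derivX.
rewrite hornerM horner_comp !hornerE -conj_node -rmorphN /= horner_map.
by rewrite -node_rev // pE // rmorphM /= mulrN1 -mulNr conj_lam opprK.
Qed.
End PNSpec.

(** * Eigenvectors of the discretised operator and the kernel of [HN] *)

Section Eigen.
Variables (R : rcfType) (n nu ny m N : nat).
Variables (A : 'I_m.+1 -> 'M[R]_n) (B : 'M[R]_(n, nu)).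
Variables (C : 'M[R]_(ny, n)) (D : 'M[R]_(ny, nu)).
Variables (tau : 'I_m.+1 -> R) (theta : 'I_(N.*2.+1) -> R) (omega xi : R).
Hypothesis theta_grid : is_grid theta.
Local Notation lam := (0 +i* omega).
Local Notation p := (pN theta lam).
Local Notation L := (Lmap A B C D tau theta xi).
Local Notation H := (HN A B C D tau theta lam xi).

Definition sample (v : 'cV[R[i]]_(n + n)) : 'M[R[i]]_(N.*2.+1, n + n) :=
  \matrix_(i, k) (p.[node theta i] * v k 0).

Lemma PN_sample v : PN theta (sample v) = \col_k (v k 0 *: p).
Proof.
have [sp _ _] := pNP theta_grid omega.
apply/colP => k; rewrite !mxE.
apply: (is_interp_uniq theta_grid (interpP theta_grid _)); split=> [|i].
  by rewrite (leq_trans (size_scale_leq _ _)).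
by rewrite hornerZ mxE mulrC.
Qed.

Lemma eval_sample v t : evalcv (PN theta (sample v)) t = p.[t] *: v.
Proof.
by rewrite PN_sample; apply/colP => k; rewrite !mxE /horner_eval hornerZ mulrC.
Qed.

(** Each delayed evaluation of [p v] is a multiple of [v], so the middle row collapses to one matrix
    acting on [v], namely [lam I - HN]. *)
Lemma Lmap_sample_mid v k :
  L (sample v) (mid N) k = lam * v k 0 - (H *m v) k 0.
Proof.
have [_ p0 _] := pNP theta_grid omega.
rewrite mxE eqxx !eval_sample p0 scale1r.
under eq_bigr => l _ do rewrite !eval_sample -!scalemxAr !scalemxAl -mulmxDl.
rewrite -mulmx_suml -!scalemxAr !scalemxAl -!mulmxDl.
set K := (K in (K *m v) k 0 = _).
have -> : H = lam%:M - K by rewrite /HN /K !opprD !addrA.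
rewrite mulmxBl mul_scalar_mx; move: (K *m v) => Kv.
by rewrite !mxE opprB addrC subrK.
Qed.

Lemma Lmap_sample_off v i k :
  i != mid N -> L (sample v) i k = lam * (p.[node theta i] * v k 0).
Proof.
have [_ _ pE] := pNP theta_grid omega.
move=> im; rewrite mxE (negPf im) PN_sample !mxE /horner_eval.
by rewrite derivZ hornerZ pE // mulrC mulrA.
Qed.

(** Off the midpoint the eigenvalue equation is collocation for each coordinate's interpolant;
    subtracting the multiple of [p] with the same value at 0 leaves a polynomial killed by
    [collocation_eq0]. *)
Lemma Lmap_eigen_sample x :
  L x = lam *: x -> x = sample (\col_k x (mid N) k).
Proof.
move=> Lx; apply/matrixP => i k; rewrite !mxE.
pose P := interp theta (fun i => x i k).
have [sP PE] := interpP theta_grid (fun i => x i k).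
have [sp p0 pE] := pNP theta_grid omega.
rewrite -PE -/P; suff -> : P = x (mid N) k *: p by rewrite hornerZ mulrC.
apply/eqP; rewrite -subr_eq0; apply/eqP.
apply: (collocation_eq0 theta_grid (omega := omega)) => [||{}i im].
- rewrite (leq_trans (size_polyD _ _)) // geq_max sP size_polyN.
  by rewrite (leq_trans (size_scale_leq _ _)).
- by rewrite hornerD hornerN hornerZ p0 mulr1 -PE node_mid // subrr.
have /matrixP/(_ i k) := Lx; rewrite !mxE (negPf im) /evalcv /derivcv !mxE.
rewrite /horner_eval -/P => PdE.
rewrite derivB derivZ !hornerD !hornerN !hornerZ PdE pE //.
by rewrite mulrBr [P.[_]]PE mulrCA.
Qed.

Lemma det_HN_eq0_LN : \det H = 0 <-> eigenvalue (LN A B C D tau theta xi) lam.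
Proof.
have [_ p0 _] := pNP theta_grid omega.
split=> [/eqP|].
  (* [det0P] yields a row vector in the left kernel, hence the transpose. *)
  rewrite -det_tr => /det0P[w w0 wH].
  pose v := w^T.
  have Hv : H *m v = 0 by rewrite -[H]trmxK -trmx_mul wH trmx0.
  apply/eigenvalueP; exists (mxvec (sample v)).
    rewrite mul_vec_LN // -linearZ; congr mxvec; apply/matrixP => i k.
    have [->|im] := eqVneq i (mid N).
      by rewrite Lmap_sample_mid Hv !mxE subr0 node_mid // p0 mul1r.
    by rewrite Lmap_sample_off // !mxE.
  rewrite mxvec_eq0; apply: contra_neq w0 => s0; apply/rowP => k.
  have /matrixP/(_ (mid N) k) := s0.
  by rewrite !mxE node_mid // p0 mul1r.
case/eigenvalueP=> y; rewrite -[y]vec_mxK mul_vec_LN // -linearZ /= mxvec_eq0.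
set x := vec_mx y => /(can_inj mxvecK) Lx x0; apply/eqP.
have xE := Lmap_eigen_sample Lx; set v := \col_k _ in xE.
rewrite -det_tr; apply/det0P; exists v^T.
  rewrite trmx_eq0; apply: contra_neq x0 => v0; rewrite xE v0.
  by apply/matrixP => i k; rewrite !mxE mulr0.
rewrite -trmx_mul; apply/eqP; rewrite trmx_eq0; apply/eqP/colP => k.
(* The middle row reads [lam v - H v = lam v]. *)
have /matrixP/(_ (mid N) k) := Lx.
rewrite {1}xE Lmap_sample_mid [RHS]mxE [v k 0]mxE => /eqP.
by rewrite subr_eq addrC -subr_eq subrr eq_sym [RHS]mxE => /eqP.
Qed.
End Eigen.

(** * Determinant identities for the Hamiltonian block matrix *)

(** Sylvester's identity: one block matrix is factored through each of its two Schur complements. *)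
Lemma det_add1_mulC (K : comNzRingType) (p q : nat)
    (Z : 'M[K]_(p, q)) (T : 'M[K]_(q, p)) :
  \det (1%:M + Z *m T) = \det (1%:M + T *m Z).
Proof.
have E1 : block_mx 1%:M (- Z) T 1%:M =
    block_mx 1%:M 0 T 1%:M *m block_mx 1%:M (- Z) 0 (1%:M + T *m Z).
  rewrite mulmx_block !mulmx1 !mul1mx !mul0mx !addr0 mulmxN.
  by rewrite addrCA addNr addr0.
have E2 : block_mx 1%:M (- Z) T 1%:M =
    block_mx 1%:M (- Z) 0 1%:M *m block_mx (1%:M + Z *m T) 0 T 1%:M.
  by rewrite mulmx_block !mulmx1 !mul1mx !mul0mx ?mulmx0 !add0r mulNmx addrK.
have := congr1 determinant E1; rewrite E2 !det_mulmx !det_lblock !det_ublock.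
by rewrite !det1 !mul1r !mulr1.
Qed.

Lemma det_mul_eq0 (F : fieldType) (n : nat) (K M : 'M[F]_n) :
  K \in unitmx -> (\det (K *m M) == 0) = (\det M == 0).
Proof. by rewrite unitmxE unitfE det_mulmx mulf_eq0 => /negPf->. Qed.

(* Both sides are [det (1 + Z T)] up to units: the left matrix is [K (1 + Z T)]
   and the right one is [diag (W, W) (1 + T Z)].  The entries of [Z] and [T]
   carry [s] because [a a'] need not be [1]. *)
Lemma det_hamiltonian_eq0 (F : fieldType) (n nu ny : nat) (E E' : 'M[F]_n)
    (b : 'M[F]_(n, nu)) (b' : 'M[F]_(nu, n))
    (c : 'M[F]_(ny, n)) (c' : 'M[F]_(n, ny))
    (d : 'M[F]_(ny, nu)) (d' : 'M[F]_(nu, ny)) (W : 'M[F]_nu) (a a' s : F)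
    (X := a' *: (d' *m c *m invmx E *m b))
    (X' := a *: (b' *m invmx E' *m c' *m d))
    (YY := b' *m invmx E' *m c' *m c *m invmx E *m b) :
  E \in unitmx -> E' \in unitmx -> W \in unitmx -> a * a' * (1 + s ^+ 2) = 1 ->
  (\det (block_mx (E + a' *: (b *m invmx W *m d' *m c)) (b *m invmx W *m b')
     (c' *m c - c' *m d *m invmx W *m d' *m c)
     (- E' - a *: (c' *m d *m invmx W *m b'))) == 0) =
  (\det (block_mx (X + X' + YY + W) (s *: X') (s *: X) W) == 0).
Proof.
move=> uE uE' uW aas.
pose K := block_mx E 0 (c' *m c) (- E').
(* [Z] is [K^-1] times the factor shown in [KZ]; the term [c' c E^-1 b] cancels the coupling block
   of [K]. *)
pose Z := block_mx (invmx E *m b) 0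
  (invmx E' *m (c' *m c *m invmx E *m b + a *: (c' *m d)))
  ((a * s) *: (invmx E' *m c' *m d)).
pose T := block_mx (a' *: (invmx W *m d' *m c)) (invmx W *m b')
  ((a' * s) *: (invmx W *m d' *m c)) 0.
have uK : K \in unitmx.
  by rewrite unitmxE det_lblock unitrM -!unitmxE uE -scaleN1r unitmxZ ?unitrN1.
have uW2 : block_mx W 0 0 W \in unitmx.
  by rewrite unitmxE det_lblock unitrM -!unitmxE uW.
have KZ : K *m Z = block_mx b 0 (- (a *: (c' *m d))) (- ((a * s) *: (c' *m d))).
  rewrite /K /Z mulmx_block !mul0mx !mulmx0 !addr0 !add0r !mulNmx -scalemxAr.
  rewrite -(mulmxA (invmx E')) !mulKVmx // !mulmxA.
  by rewrite opprD addNKr.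
have WT : block_mx W 0 0 W *m T =
    block_mx (a' *: (d' *m c)) b' ((a' * s) *: (d' *m c)) 0.
  rewrite /T mulmx_block !mul0mx !mulmx0 !addr0 !add0r -!scalemxAr.
  by rewrite -!mulmxA !mulKVmx.
transitivity (\det (K *m (1%:M + Z *m T)) == 0).
  congr (\det _ == 0); rewrite mulmxDr mulmx1 mulmxA KZ /T mulmx_block.
  rewrite !mul0mx !mulmx0 !addr0 !mulNmx -!scalemxAl -!scalemxAr add_block_mx.
  rewrite add0r !scalerA !mulmxA; congr block_mx.
  (* In the lower left block the two contributions carry [a a'] and [a a' s^2], which add up to 1 by
     [aas]. *)
  rewrite -opprD -scalerDl [a * s * _]mulrACA -expr2 -{1}[a * a']mulr1.
  by rewrite -mulrDr aas scale1r.
rewrite det_mul_eq0 // det_add1_mulC -[LHS](det_mul_eq0 _ uW2).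
congr (\det _ == 0).
rewrite mulmxDr mulmx1 mulmxA WT /Z mulmx_block.
rewrite !mul0mx !mulmx0 !addr0 -!scalemxAl -!scalemxAr add_block_mx add0r.
rewrite !mulmxDr -!scalemxAr !mulmxA /X /X' /YY !scalerA; congr block_mx.
- by rewrite addrC; congr (_ + _); rewrite addrA addrAC.
- by rewrite add0r [s * _]mulrC.
- by rewrite add0r [s * _]mulrC.
by rewrite addr0.
Qed.

Lemma sum_block_diag (V : nmodType) (p q : nat) (I : finType) (P : pred I)
    (F : I -> 'M[V]_p) (G : I -> 'M[V]_q) :
  \sum_(i | P i) block_mx (F i) 0 0 (G i) =
  block_mx (\sum_(i | P i) F i) 0 0 (\sum_(i | P i) G i).
Proof.
elim/big_rec3: _ => [|i x y z _ ->]; first by rewrite block_mx0.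
by rewrite add_block_mx !addr0.
Qed.

(** * Conjugate transposition *)

Section CTMX.
Variable R : rcfType.

Lemma ctmxM (p q r : nat) (M : 'M[R[i]]_(p, q)) (M' : 'M[R[i]]_(q, r)) :
  ctmx (M *m M') = ctmx M' *m ctmx M.
Proof. by rewrite /ctmx trmx_mul map_mxM. Qed.

Lemma ctmxZ (p q : nat) (a : R[i]) (M : 'M[R[i]]_(p, q)) :
  ctmx (a *: M) = Num.conj a *: ctmx M.
Proof. by rewrite /ctmx linearZ /= map_mxZ. Qed.

Lemma ctmx_inv (n : nat) (M : 'M[R[i]]_n) : ctmx (invmx M) = invmx (ctmx M).
Proof. by rewrite /ctmx trmx_inv map_invmx. Qed.

Lemma ctmx_real (p q : nat) (M : 'M[R]_(p, q)) : ctmx (mxC M) = mxC M^T.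
Proof. by apply/matrixP => i j; rewrite !mxE; apply: conjc_real. Qed.

Lemma ctmx_unit (n : nat) (M : 'M[R[i]]_n) :
  (ctmx M \in unitmx) = (M \in unitmx).
Proof. by rewrite /ctmx map_unitmx unitmx_tr. Qed.

End CTMX.

(** * Block form of [HN] and the passage to [MN] *)

Section Singular.
Variables (R : rcfType) (n nu ny m N : nat).
Variables (A : 'I_m.+1 -> 'M[R]_n) (B : 'M[R]_(n, nu)).
Variables (C : 'M[R]_(ny, n)) (D : 'M[R]_(ny, nu)).
Variables (tau : 'I_m.+1 -> R) (theta : 'I_(N.*2.+1) -> R) (omega xi : R).
Hypothesis theta_grid : is_grid theta.
Local Notation lam := (0 +i* omega).
Local Notation p := (pN theta lam).
Local Notation E := (charmx A tau theta lam).
Local Notation W := (mxC (Dxi D xi)).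

(** Conjugation negates [lam] and, by [pN_conj], turns the delays [-tau] into [tau]; this identifies
    the lower right block of [HN] as [-E^*] up to its [N1] term. *)
Lemma ctmx_charmx :
  ctmx E = - (lam%:M + mxC (A ord0)^T
    + \sum_(l < m.+1 | l != ord0) p.[(tau l)%:C] *: mxC (A l)^T).
Proof.
have realE (x : R) : Num.conj x%:C = x%:C by apply: conjc_real.
apply/matrixP => i j; rewrite !mxE !summxE !rmorphB rmorph_sum rmorphMn /=.
rewrite conj_lam realE !opprD eq_sym mulNrn; congr (_ - _ - _).
by apply: eq_bigr => l _; rewrite !mxE rmorphM /= realE [in RHS]pN_conj.
Qed.

Lemma HN_block :
  HN A B C D tau theta lam xi =
  block_mx
    (E + p.[(tau ord0)%:C] *: (mxC B *m invmx W *m mxC D^T *m mxC C))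
    (mxC B *m invmx W *m mxC B^T)
    (mxC C^T *m mxC C - mxC C^T *m mxC D *m invmx W *m mxC D^T *m mxC C)
    (- ctmx E
     - p.[(- tau ord0)%:C] *: (mxC C^T *m mxC D *m invmx W *m mxC B^T)).
Proof.
rewrite /HN /M0 /N1 /Nm1.
under eq_bigr => l _.
  rewrite /Mpos /Mneg /mxC !map_block_mx !map_mx0 !scale_block_mx !scaler0.
  rewrite add_block_mx !addr0 add0r.
  over.
rewrite sum_block_diag scalar_mx_block /mxC !map_block_mx !map_mx0.
rewrite !scale_block_mx !scaler0 ctmx_charmx opprK /charmx /mxC.
rewrite !(map_mxD, map_mxN, map_mxM, map_invmx).
rewrite !(opp_block_mx, add_block_mx, oppr0, addr0, add0r, scalerN, opprK,
  opprD).
congr block_mx.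
congr (_ + _ - _); rewrite -sumrN; apply: eq_bigr => l _.
by rewrite map_mxN scalerN opprK.
Qed.

Lemma det_HN_eq0_MN :
  E \in unitmx -> p.[(- tau ord0)%:C] != 0 -> Dxi D xi \in unitmx ->
  \det (HN A B C D tau theta lam xi) = 0 <->
  eigenvalue (MN A B C D tau theta omega) (xi ^+ 2)%:C.
Proof.
move=> uE p0 uD.
have uW : W \in unitmx by rewrite map_unitmx.
have -> : eigenvalue (MN A B C D tau theta omega) (xi ^+ 2)%:C =
    (\det (MN A B C D tau theta omega - (xi ^+ 2)%:C%:M) == 0).
  rewrite /eigenvalue /eigenspace kermx_eq0 row_free_unit unitmxE unitfE.
  by rewrite negbK.
set s := sqrtC (rN tau theta omega).
have pc : p.[(tau ord0)%:C] = Num.conj p.[(- tau ord0)%:C] by apply: pN_conj.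
(* The two values are conjugate, so this is the definition of [rN]: [|p|^2 (1 + rN) = 1]. *)
have aas : p.[(- tau ord0)%:C] * p.[(tau ord0)%:C] * (1 + s ^+ 2) = 1.
  rewrite pc -normCK sqrtCK /rN addrCA subrr addr0 divff //.
  by rewrite expf_neq0 ?normr_eq0.
have uE' : ctmx E \in unitmx by rewrite ctmx_unit.
suff <- : (\det (HN A B C D tau theta lam xi) == 0) =
    (\det (MN A B C D tau theta omega - (xi ^+ 2)%:C%:M) == 0) by split=> /eqP.
rewrite HN_block (det_hamiltonian_eq0 _ _ _ _ _ _ uE uE' uW aas).
congr (\det _ == 0).
rewrite scalar_mx_block /MN -/s opp_block_mx add_block_mx oppr0 !addr0.
(* Subtracting [xi^2] turns [D^T D] into [Dxi] in both diagonal blocks. *)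
have WE : mxC (D^T *m D) - (xi ^+ 2)%:C%:M = W.
  by rewrite /mxC map_mxB map_scalar_mx.
rewrite -[in RHS]addrA WE /XN /YN ctmxZ !ctmxM ctmx_inv !ctmx_real.
rewrite [Num.conj _](_ : _ = p.[(- tau ord0)%:C]); last by rewrite pc conjCK.
by rewrite trmx_mul trmxK /mxC !map_mxM !mulmxA.
Qed.
End Singular.

(** [invmx] and [^-1] are total functions, so the third statement is guarded by the two conditions
    under which the formula for [MN] is meaningful. *)
Theorem theorem3p4 (R : rcfType) (n nu ny m N : nat)
    (A : 'I_m.+1 -> 'M[R]_n) (B : 'M[R]_(n, nu)) (C : 'M[R]_(ny, n))
    (D : 'M[R]_(ny, nu)) (tau : 'I_m.+1 -> R) (theta : 'I_(N.*2.+1) -> R)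
    (omega xi : R)
    (tau_ge0 : forall i, 0 <= tau i)
    (tau_max : \big[Num.max/tau ord0]_(i < m.+1) tau i = 1)
    (N_gt0 : (0 < N)%N)
    (theta_grid : is_grid theta)
    (omega_ge0 : 0 <= omega)
    (xi_ge0 : 0 <= xi)
    (Dxi_unit : Dxi D xi \in unitmx) :
  (\det (HN A B C D tau theta (0 +i* omega) xi) = 0
     <-> eigenvalue (LN A B C D tau theta xi) (0 +i* omega))
  /\ (charmx A tau theta (0 +i* omega) \in unitmx ->
      (pN theta (0 +i* omega)).[(- tau ord0)%:C] != 0 ->
      (\det (HN A B C D tau theta (0 +i* omega) xi) = 0
         <-> eigenvalue (MN A B C D tau theta omega) (xi ^+ 2)%:C)).
Proof.
split=> [|uE p0]; first exact: det_HN_eq0_LN.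
exact: det_HN_eq0_MN.
Qed.
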